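(* Let $G= \mathbb{Z}_4\times H$ where $H$ is a finite abelian group of odd order, let $a=(2,0)$ be the unique element of order two in $G$, and let $\mathcal{C}\subseteq G$ be an inverse-closed subset with $0\notin\mathcal{C}$. Suppose that the Cayley graph $X=X(G,\mathcal{C})$ admits perfect state transfer. If $a\in\mathcal{C}$, then all eigenvalues of $X$ are odd integers, and $-1$ is an eigenvalue of $X$ with multiplicity $|G|/2$. If $a\notin\mathcal{C}$, then all eigenvalues of $X$ are even integers, and $0$ is an eigenvalue of $X$ with multiplicity $|G|/2$.
   Context: The Cayley graph $X(G,\mathcal{C})$ of an abelian group $G$ (written additively) with inverse-closed connection set $\mathcal{C}$ has vertex set $G$, with $g$ and $h$ adjacent iff $h-g\in\mathcal{C}$. Eigenvalues of a graph are those of its adjacency matrix $A$. The transition matrix at time $t\in\mathbb{R}$ is $U(t)=e^{itA}$; $X$ admits perfect state transfer if $|U(\tau)_{u,v}|=1$ for some time $\tau$ and some distinct vertices $u,v$. *)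

(* Defs.v *)
From HB Require Import structures.
From mathcomp Require Import all_boot all_order all_algebra.
From mathcomp Require Import all_classical all_reals all_analysis.
From mathcomp Require Import complex.

Set Implicit Arguments.
Unset Strict Implicit.
Unset Printing Implicit Defensive.

Import Order.TTheory GRing.Theory Num.Theory.
Import numFieldNormedType.Exports.

Local Open Scope classical_set_scope.
Local Open Scope ring_scope.

(* MathComp equips a product with finType and zmodType structures separately;
   this is their join. *)
HB.instance Definition _ (U V : finZmodType) := Finite.on (U * V)%type.

(* The limit is entrywise (the topology on matrices is the product one).  For
   K = R[i] the series converges for every M, so the default value of lim on
   divergent sequences plays no role. *)
Definition expmx (K : numFieldType) (n : nat) (M : 'M[K]_n) : 'M[K]_n :=
  lim (series (fun k : nat => (k`!)%:R^-1 *: M ^+ k) @ \oo).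

(* A matrix indexed by a finite type T is a matrix over 'I_#|T|, read through
   the bijections enum_val : 'I_#|T| -> T and enum_rank : T -> 'I_#|T|. *)
Definition adjmx (K : pzSemiRingType) (T : finType) (e : rel T) : 'M[K]_#|T| :=
  \matrix_(i, j) (e (enum_val i) (enum_val j))%:R.

Definition transition_matrix (R : realType) (T : finType) (e : rel T) (t : R) :
    'M[R[i]]_#|T| :=
  expmx ((0 +i* t)%C *: adjmx R[i] e).

Definition perfect_state_transfer (R : realType) (T : finType) (e : rel T) :
    Prop :=
  exists (tau : R) (u v : T),
    u != v /\
    `|transition_matrix e tau (enum_rank u) (enum_rank v)| = 1.

Definition eigenvalue_mult (F : fieldType) (n : nat) (A : 'M[F]_n) (z : F)
    (m : nat) : Prop :=
  eigenvalue A z /\ mup z (char_poly A) = m.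

Definition cayley (G : finZmodType) (C : {set G}) : rel G :=
  [rel g h | h - g \in C].

(* Main.v *)
Require Import Defs.
From HB Require Import structures.
From mathcomp Require Import all_boot all_order all_algebra.
From mathcomp Require Import cyclic all_field.
From mathcomp Require Import all_classical all_reals all_analysis.
From mathcomp Require Import complex.
From mathcomp Require Import ring lra zify.

(** The translations of G commute and have finite order, so they, and with them
    A and U(t), are diagonal in a basis indexed by characters chi of G, with
    eigenvalues chi(g), lam(chi) = sum_(g in C) chi(g) and e^(i t lam(chi)).  The
    matrix U(t) is circulant, and by Parseval an entry of modulus 1 at
    displacement d is the only nonzero entry of its row; hence
    e^(i t lam(chi)) = gamma chi(d) for all chi, and 2d = 0 because lam(chi) is
    real, so d = a.  As the trace of A is 0, this makes every lam(chi) rational,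
    hence an integer, and its parity depends only on the sign chi(a).

    A character with chi(a) = -1 is (j, h) |-> (+-i)^j phi(h), where phi is a
    character of H, and then lam(chi) = F(phi) +- i B(phi), with F and B the
    transforms of c_0 - c_2 and c_1 - c_3, c_j being the indicator of the layer
    {h | (j, h) in C}.  Working modulo 2 in the ring of algebraic integers, where
    2 is prime to |H|, one gets c_1 = c_3, and c_0 = c_2 away from h = 0.  So
    lam(chi) = - [a in C] whenever chi(a) = -1, which is half of the characters,
    and |C| = [a in C] modulo 2 settles the parity of the other eigenvalues. *)

Set Implicit Arguments.
Unset Strict Implicit.
Unset Printing Implicit Defensive.

Import Order.TTheory GRing.Theory Num.Theory.
Import numFieldNormedType.Exports.
Local Open Scope ring_scope.

(** * Characters of a finite abelian group *)

(** The minimal polynomial divides ['X^m - 1], which is separable because [m] is nonzero in [K]. *)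
Lemma diagonalizable_finite_order (K : closedFieldType) (n m : nat) (M : 'M[K]_n) :
  (m%:R != 0 :> K) -> M ^+ m = 1 -> diagonalizable M.
Proof.
case: n M => [|n] M m0 Mm.
  by exists 1%:M; rewrite ?unitmx1 //; apply/is_diag_mxP; case.
apply/diagonalizableP.
have [rs Drs] := closed_field_poly_normal ('X^m - 1 : {poly K}).
have m_gt0 : (0 < m)%N by case: m m0 {Mm Drs} => //; rewrite eqxx.
move: Drs; rewrite (monicP (monicXnsubC 1 m_gt0)) scale1r => Drs.
exists rs; first by rewrite -separable_prod_XsubC -Drs separable_Xn_sub_1.
rewrite -Drs mxminpoly_min //.
by rewrite rmorphB rmorphXn rmorph1 /= horner_mx_X Mm subrr.
Qed.
Section Characters.
Variables (K : numClosedFieldType) (G : finZmodType).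
Implicit Types (g h : G) (chi : G -> K).

Definition additive_char chi : Prop :=
  chi 0 = 1 /\ forall g h, chi (g + h) = chi g * chi h.

Definition translation_mx g : 'M[K]_#|G| :=
  \matrix_(i, j) (enum_val j == enum_val i + g)%:R.

Lemma translation_mx0 : translation_mx 0 = 1%:M.
Proof.
by apply/matrixP => i j; rewrite !mxE addr0 (inj_eq enum_val_inj) eq_sym.
Qed.

Lemma mul_translation_mx g n (M : 'M[K]_(#|G|, n)) i j :
  (translation_mx g *m M) i j = M (enum_rank (enum_val i + g)) j.
Proof.
rewrite mxE (bigD1 (enum_rank (enum_val i + g))) //= big1 => [|k nk].
  by rewrite mxE enum_rankK eqxx mul1r addr0.
rewrite mxE; case: eqP => [E|_]; last by rewrite mul0r.
by rewrite -E enum_valK eqxx in nk.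
Qed.

Lemma translation_mxD g h :
  translation_mx (g + h) = translation_mx g *m translation_mx h.
Proof.
apply/matrixP => i j.
by rewrite mul_translation_mx !mxE enum_rankK addrA.
Qed.

Lemma translation_mxMn g m : translation_mx (g *+ m) = translation_mx g ^+ m.
Proof.
elim: m => [|m IHm]; first by rewrite mulr0n translation_mx0.
by rewrite mulrS translation_mxD IHm exprS.
Qed.

Lemma mxtrace_translation g : \tr (translation_mx g) = (#|G| * (g == 0))%:R.
Proof.
rewrite /mxtrace (eq_bigr (fun=> (g == 0)%:R)); last first.
  by move=> i _; rewrite mxE -{1}[enum_val i]addr0 (inj_eq (addrI _)) eq_sym.
by rewrite sumr_const card_ord natrM mulr_natl.
Qed.

(** Translation by [g] permutes the group, so the sum of all elements equals itself plus
    [g *+ #|G|]. *)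
Lemma mulrn_card g : g *+ #|G| = 0.
Proof.
apply: (addrI (\sum_(h : G) h)); rewrite addr0.
by rewrite [in RHS](reindex_inj (addIr g)) /= big_split sumr_const.
Qed.

Lemma card_zmod_neq0 : #|G|%:R != 0 :> K.
Proof. by rewrite pnatr_eq0 -lt0n; apply/card_gt0P; exists 0. Qed.

(** The translations commute and have order dividing [#|G|], so one [Q] diagonalizes them all; as
    [translation_mx] turns sums into products, each diagonal entry is a character. That every
    character occurs is settled by [char_complete]. *)
Lemma translation_codiagonalizable :
  exists2 Q : 'M[K]_#|G|, Q \in unitmx &
    exists2 X : 'I_#|G| -> G -> K, (forall i, additive_char (X i)) &
      forall g, translation_mx g = invmx Q *m diag_mx (\row_i X i g) *m Q.
Proof.
have [|Q Qu /allP Qd] := (codiagonalizableP [seq translation_mx g | g : G]).1.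
  split=> [M N /mapP[g _ ->] /mapP[h _ ->]|M /mapP[g _ ->]].
    by rewrite /comm_mx -!translation_mxD addrC.
  apply: (diagonalizable_finite_order card_zmod_neq0).
  by rewrite -translation_mxMn mulrn_card translation_mx0.
have {}Qd g : exists D, translation_mx g = invmx Q *m diag_mx D *m Q.
  have /diagonalizable_forPex[D /(simmxLR Qu) ->] :
    diagonalizable_for Q (translation_mx g).
    by apply: Qd; apply/mapP; exists g; rewrite ?mem_enum.
  by exists D; rewrite mxpoly.conjVmx.
have [D QD] := boolp.choice Qd.
have DQ g : diag_mx (D g) = Q *m translation_mx g *m invmx Q.
  by rewrite QD !mulmxA mulmxV // mul1mx mulmxK.
exists Q => //; exists (fun i g => D g 0 i) => [i|g]; last first.
  by rewrite QD; congr (_ *m diag_mx _ *m _); apply/rowP => i; rewrite !mxE.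
have DE g : D g 0 i = (Q *m translation_mx g *m invmx Q) i i.
  by rewrite -DQ mxE eqxx mulr1n.
split=> [|g h]; first by rewrite DE translation_mx0 mulmx1 mulmxV // mxE eqxx.
have -> : D (g + h) 0 i = diag_mx (D (g + h)) i i by rewrite mxE eqxx.
suff -> : diag_mx (D (g + h)) = diag_mx (D g) *m diag_mx (D h).
  by rewrite mulmx_diag !mxE eqxx.
by rewrite !DQ translation_mxD !mulmxA mulmxKV.
Qed.

Section Values.
Variables (chi : G -> K) (chiP : additive_char chi).

Lemma char_mulrn g m : chi (g *+ m) = chi g ^+ m.
Proof.
elim: m => [|m IHm]; first by rewrite mulr0n expr0 chiP.1.
by rewrite mulrS chiP.2 IHm exprS.
Qed.

Lemma char_unity_root g : chi g ^+ #|G| = 1.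
Proof. by rewrite -char_mulrn mulrn_card chiP.1. Qed.

Lemma charN_mul g : chi (- g) * chi g = 1.
Proof. by rewrite -chiP.2 addNr chiP.1. Qed.

Lemma char_neq0 g : chi g != 0.
Proof.
by apply/eqP => cg0; have /eqP := charN_mul g; rewrite cg0 mulr0 eq_sym oner_eq0.
Qed.

Lemma norm_char g : `|chi g| = 1.
Proof.
apply/eqP; rewrite -(@pexpr_eq1 _ _ #|G|) ?normr_ge0 //; last first.
  by apply/card_gt0P; exists 0.
by rewrite -normrX char_unity_root normr1.
Qed.

Lemma conj_char g : (chi g)^* = chi (- g).
Proof.
apply: (mulIf (char_neq0 g)).
by rewrite charN_mul mulrC -normCK norm_char expr1n.
Qed.

End Values.

Lemma additive_char1 : additive_char (fun=> 1).
Proof. by split=> // g h; rewrite mulr1. Qed.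

Section Orthogonality.
Variables (X : 'I_#|G| -> G -> K) (XP : forall i, additive_char (X i)).
Hypothesis X_orth : forall g, \sum_i X i g = (#|G| * (g == 0))%:R.

(** After exchanging the sums, [X_orth] at [h - g] leaves only the term [h = g]. *)
Lemma char_inversion (f : G -> K) g :
  \sum_i (\sum_h f h * X i h) * X i (- g) = #|G|%:R * f g.
Proof.
under eq_bigr do rewrite mulr_suml.
rewrite exchange_big /= (bigD1 g) //= [X in _ + X]big1 ?addr0 => [|h hg].
  under eq_bigr => i _ do rewrite -mulrA -(XP i).2 subrr.
  by rewrite -mulr_sumr X_orth eqxx muln1 mulrC.
under eq_bigr => i _ do rewrite -mulrA -(XP i).2.
by rewrite -mulr_sumr X_orth subr_eq0 (negPf hg) muln0 mulr0.
Qed.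

(** Since [X i h] has conjugate [X i (- h)], this is inversion at [h], weighted by the conjugate of
    [f h] and summed over [h]. *)
Lemma char_parseval (f : G -> K) :
  \sum_i `|\sum_h f h * X i h| ^+ 2 = #|G|%:R * \sum_h `|f h| ^+ 2.
Proof.
under eq_bigr do rewrite normCK rmorph_sum mulr_sumr /=.
rewrite exchange_big mulr_sumr; apply: eq_bigr => h _ /=.
under eq_bigr => i _.
  by rewrite rmorphM /= (conj_char (XP i)) [X in _ * X]mulrC mulrA over.
by rewrite -mulr_suml char_inversion normCK mulrA.
Qed.

(** If the transform of [chi (- g)] vanished at every [X i], inversion at 0 would give
    [#|G|%:R = 0]; where it does not vanish, [X i] is [chi]. *)
Lemma char_complete chi : additive_char chi -> exists i, X i = chi.
Proof.
move=> chiP.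
have [i nz] : exists i, \sum_g chi (- g) * X i g != 0.
  apply/existsP; rewrite -[X in is_true X]negbK negb_exists.
  apply/negP => /forallP z; have := card_zmod_neq0; apply/negP; rewrite negbK.
  have := char_inversion (fun g => chi (- g)) 0.
  rewrite oppr0 chiP.1 mulr1 => <-; apply/eqP/big1 => i _.
  by have /negPn/eqP-> := z i; rewrite mul0r.
exists i; apply/funext => h; apply/eqP; rewrite -subr_eq0.
(* Translating the summation variable by [h] multiplies this nonzero sum by [chi (- h) * X i h], so
   that factor is 1. *)
have : \sum_g chi (- g) * X i g =
       (chi (- h) * X i h) * \sum_g chi (- g) * X i g.
  rewrite {1}(reindex_inj (addIr h)) mulr_sumr; apply: eq_bigr => g _.
  by rewrite opprD chiP.2 (XP i).2 /=; ring.
rewrite -{1}[X in X = _]mul1r => /(mulIf nz)/esym E.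
rewrite subr_eq0; apply/eqP/(mulfI (char_neq0 chiP (- h))).
by rewrite E charN_mul.
Qed.

End Orthogonality.
End Characters.

(** * Algebraic integers *)

Section AlgebraicIntegers.
Variable K : numClosedFieldType.
Implicit Types z : K.

Definition alg_int z : Prop := integralOver (intr : int -> K) z.

Lemma alg_int_intr (m : int) : alg_int m%:~R.
Proof. exact: (integral_id (intr : {rmorphism int -> K})). Qed.

Lemma alg_intB z1 z2 : alg_int z1 -> alg_int z2 -> alg_int (z1 - z2).
Proof. exact: (@integral_sub _ _ (intr : {rmorphism int -> K})). Qed.

Lemma alg_intD z1 z2 : alg_int z1 -> alg_int z2 -> alg_int (z1 + z2).
Proof. exact: (@integral_add _ _ (intr : {rmorphism int -> K})). Qed.

Lemma alg_intM z1 z2 : alg_int z1 -> alg_int z2 -> alg_int (z1 * z2).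
Proof. exact: (@integral_mul _ _ (intr : {rmorphism int -> K})). Qed.

Lemma alg_intX z m : alg_int z -> alg_int (z ^+ m).
Proof.
move=> zi; elim: m => [|m IHm]; first exact: (alg_int_intr 1).
by rewrite exprS; apply: alg_intM.
Qed.

Lemma alg_int_sum (I : Type) (r : seq I) (P : pred I) (F : I -> K) :
  (forall i, P i -> alg_int (F i)) -> alg_int (\sum_(i <- r | P i) F i).
Proof.
move=> Fi; apply: big_ind => //; first exact: (alg_int_intr 0).
exact: alg_intD.
Qed.

Lemma alg_int_unity_root z m : (0 < m)%N -> z ^+ m = 1 -> alg_int z.
Proof.
move=> m0 zm; exists ('X^m - 1); first exact: monicXnsubC.
rewrite rmorphB rmorph1 /= map_polyXn /root !hornerE zm.
by rewrite subrr.
Qed.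

(** The monic integer polynomial that kills [ratr q] in [K] kills [q] in [rat], hence its image in
    [algC], where rational algebraic integers are known to be integers. *)
Lemma rat_alg_int (q : rat) : alg_int (ratr q) -> exists m : int, q = m%:~R.
Proof.
case=> p p_mon.
have -> : map_poly (intr : int -> K) p = map_poly ratr (map_poly intr p).
  by rewrite -map_poly_comp; apply: eq_map_poly => m; rewrite /= ratr_int.
rewrite fmorph_root => pq.
have : (ratr q : algC) \in Num.int.
  apply: Cint_rat_Aint; first exact: Crat_rat.
  apply: (@root_monic_Aint (map_poly intr p)).
  - have -> : map_poly intr p = map_poly ratr (map_poly intr p) :> {poly algC}.
      by rewrite -map_poly_comp; apply: eq_map_poly => m; rewrite /= ratr_int.
    by rewrite fmorph_root.
  - exact: monic_map.
  - by apply/polyOverP => i; rewrite coef_map /= rpred_int.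
case/intrP => m; rewrite -[RHS]ratr_int => /fmorph_inj ->.
by exists m.
Qed.

Lemma dvdz_alg_int (m d : int) z :
  alg_int z -> m%:~R = d%:~R * z -> (d %| m)%Z.
Proof.
move=> zi mE; have [d0|d0] := eqVneq d 0.
  by move/eqP: mE; rewrite d0 mul0r intr_eq0 => /eqP ->.
have zE : z = ratr (m%:~R / d%:~R).
  rewrite rmorphM fmorphV /= !ratr_int mE mulrAC divff ?mul1r //.
  by rewrite intr_eq0.
move: zi; rewrite zE => /rat_alg_int [l lE]; apply/dvdzP; exists l.
apply: (@intr_inj rat); rewrite intrM -lE mulfVK //.
by rewrite intr_eq0.
Qed.

Section Divisibility.
Variables (G : finZmodType) (X : 'I_#|G| -> G -> K).
Hypotheses (XP : forall i, additive_char (X i))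
           (X_orth : forall g, \sum_i X i g = (#|G| * (g == 0))%:R).

Lemma alg_int_char (chi : G -> K) g : additive_char chi -> alg_int (chi g).
Proof.
move=> chiP; apply: (@alg_int_unity_root _ #|G|); last exact: char_unity_root.
by apply/card_gt0P; exists 0.
Qed.

(* By inversion, #|G| * f g / d is an algebraic integer, hence an integer. *)
Lemma coef_dvdz_of_transform (f : G -> int) (d : int) :
  coprimez d #|G| ->
  (forall chi : G -> K, additive_char chi ->
     exists2 z, alg_int z & \sum_g (f g)%:~R * chi g = d%:~R * z) ->
  forall g, (d %| f g)%Z.
Proof.
move=> dG fd g.
have /boolp.choice[z zP] (i : 'I_#|G|) : exists z,
    alg_int z /\ \sum_g (f g)%:~R * X i g = d%:~R * z.
  by have [z z1 z2] := fd _ (XP i); exists z.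
rewrite -(Gauss_dvdzr _ dG).
apply: (@dvdz_alg_int _ _ (\sum_i z i * X i (- g))).
  apply: alg_int_sum => i _; apply: alg_intM; first exact: (zP i).1.
  exact: alg_int_char.
rewrite intrM -(char_inversion XP X_orth (fun h => (f h)%:~R) g) mulr_sumr.
by apply: eq_bigr => i _; rewrite (zP i).2 mulrA.
Qed.

End Divisibility.
End AlgebraicIntegers.

(** * The matrix exponential *)

Section ComplexExponential.
Variable R : realType.
Implicit Types (x y t : R).

Definition cis t : R[i] := (cos t +i* sin t)%C.

Lemma cis0 : cis 0 = 1.
Proof. by rewrite /cis cos0 sin0. Qed.

Lemma cisD x y : cis (x + y) = cis x * cis y.
Proof.
rewrite /cis cosD sinD; apply/eqP; rewrite eq_complex /= eqxx /=.
by rewrite [sin x * _ + _]addrC eqxx.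
Qed.

Lemma norm_cis t : `|cis t| = 1.
Proof. by rewrite normc_def /= cos2Dsin2 sqrtr1. Qed.

Lemma cis_neq0 t : cis t != 0.
Proof. by rewrite -normr_eq0 norm_cis oner_eq0. Qed.

Lemma cis_pi_int (m : int) : cis (pi *~ m) = (-1) ^+ odd `|m|%N.
Proof.
have cis_pi : cis pi = -1 by apply/eqP; rewrite eq_complex /= cospi sinpi oppr0 !eqxx.
have cisN : cis (- pi) = -1.
  by apply/eqP; rewrite eq_complex /= cosN sinN cospi sinpi oppr0 !eqxx.
have cisn x (k : nat) : cis x = -1 -> cis (x *+ k) = (-1) ^+ odd k.
  move=> cx; rewrite signr_odd; elim: k => [|k IHk]; first by rewrite mulr0n cis0.
  by rewrite mulrS cisD IHk cx exprS.
case: (intP m) => [|k|k]; rewrite ?mulr0z ?cis0 //.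
  by rewrite -pmulrn cisn.
by rewrite mulrNz -mulNrz -pmulrn cisn // abszN.
Qed.

(** A sign has imaginary part 0, so [sin t = 0]. Subtracting [m] times [pi] leaves a remainder in
    [[0, pi)], and [sin] is positive on the open interval, so the remainder is 0. *)
Lemma cis_sign_eq t (b : bool) :
  cis t = (-1) ^+ b -> exists m : int, t = pi *~ m /\ odd `|m|%N = b.
Proof.
move=> tb; pose m := Num.floor (t / pi); exists m.
have pi0 : 0 < pi :> R by exact: pi_gt0.
have st : sin t = 0.
  have := congr1 (@complex.Im R) tb; rewrite /=.
  by case: b {tb} => /=; rewrite ?oppr0.
have tm : t = pi *~ m.
  have /andP[r0 r1] : 0 <= t - pi *~ m < pi.
    have /andP[m0 m1] := floor_itv (t / pi); move: m0 m1.
    rewrite ler_pdivlMr // ltr_pdivrMr // intrD mulrDl mul1r -/m [_ * pi]mulrC.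
    rewrite mulrzr.
    by rewrite subr_ge0 ltrBlDl => -> ->.
  have sr : sin (t - pi *~ m) = 0.
    rewrite -mulrNz sinD st mul0r add0r.
    have -> : sin (pi *~ - m) = complex.Im (cis (pi *~ - m)) by [].
    rewrite cis_pi_int; case: odd; last by rewrite mulr0.
    by rewrite /= oppr0 mulr0.
  move: r0; rewrite le_eqVlt => /orP[/eqP/esym/eqP|r0]; 
    first by rewrite subr_eq0 => /eqP.
  by have := sin_gt0_pi (introT andP (conj r0 r1)); rewrite sr ltxx.
split=> //; move: tb; rewrite {1}tm cis_pi_int.
exact: signr_inj.
Qed.

End ComplexExponential.

Section MatrixExponential.
Local Open Scope classical_set_scope.

Lemma cvg_mx_entries (K : numFieldType) (m n : nat) (u : nat -> 'M[K]_(m, n))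
    (M : 'M[K]_(m, n)) :
  (forall i j, (fun k => u k i j) @ \oo --> M i j) -> u @ \oo --> M.
Proof.
move=> uM; apply/cvg_ballP => e e0.
have : forall i : 'I_m, \forall k \near \oo, forall j, ball (M i j) e (u k i j).
  move=> i; apply: filter_forall => j; have /cvg_ballP := uM i j; exact.
move/filter_forall; apply: filterS => k kP; split => // i j; exact: kP.
Qed.

Lemma lim_mx_entries (K : numFieldType) (m n : nat) (u : nat -> 'M[K]_(m, n))
    (M : 'M[K]_(m, n)) :
  (forall i j, (fun k => u k i j) @ \oo --> M i j) -> lim (u @ \oo) = M.
Proof.
move=> uM; have /cvgP uL := cvg_mx_entries uM.
apply/matrixP => i j; apply: (cvg_unique (@norm_hausdorff _ K^o)) (uM i j).
apply/cvg_ballP => e e0; have /cvg_ballP/(_ e e0) := uL.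
by apply: filterS => k [_ kP]; exact: kP.
Qed.

Lemma exprmx_conj (K : fieldType) (n k : nat) (Q : 'M[K]_n) (d : 'rV[K]_n) :
  Q \in unitmx ->
  (invmx Q *m diag_mx d *m Q) ^+ k =
  invmx Q *m diag_mx (\row_i d 0 i ^+ k) *m Q.
Proof.
move=> Qu; elim: k => [|k IHk].
  rewrite expr0 (_ : diag_mx _ = 1%:M) ?mulmx1 ?mulVmx //.
  by apply/matrixP => i j; rewrite !mxE expr0.
rewrite exprS IHk [LHS]mulmxA !mulmxA mulmxK // -!mulmxA; congr (_ *m _).
rewrite !mulmxA mulmx_diag; congr (diag_mx _ *m _).
by apply/rowP => i; rewrite !mxE exprS.
Qed.

(** Conjugation by [Q] passes through powers, so each entry of a partial sum is a fixed linear
    combination of the scalar partial sums. *)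
Lemma expmx_conj (K : numFieldType) (n : nat) (Q : 'M[K]_n) (d e : 'rV[K]_n) :
  Q \in unitmx ->
  (forall i, series (fun k => (k`!)%:R^-1 * d 0 i ^+ k) @ \oo --> e 0 i) ->
  expmx (invmx Q *m diag_mx d *m Q) = invmx Q *m diag_mx e *m Q.
Proof.
move=> Qu de; apply: lim_mx_entries => i j.
have entryE (c : 'rV[K]_n) : (invmx Q *m diag_mx c *m Q) i j =
    \sum_k invmx Q i k * c 0 k * Q k j.
  by rewrite !mxE; apply: eq_bigr => k _; rewrite mul_mx_diag mxE.
rewrite (_ : (fun N => _) = fun N : nat => \sum_k
   invmx Q i k * series (fun l => (l`!)%:R^-1 * d 0 k ^+ l) N * Q k j); last first.
  apply/funext => N; rewrite /series /= summxE.
  under eq_big_nat => l _ do rewrite exprmx_conj // mxE entryE mulr_sumr.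
  rewrite exchange_big; apply: eq_bigr => k _ /=.
  rewrite mulr_sumr mulr_suml; apply: eq_bigr => l _; rewrite mxE; ring.
rewrite entryE; apply: cvg_big => //; first by move=> x; apply: add_continuous.
move=> k _; apply: cvgM; last exact: cvg_cst.
apply: cvgM; [exact: cvg_cst|exact: de].
Qed.

End MatrixExponential.

Section CisSeries.
Local Open Scope classical_set_scope.
Variable R : realType.
Local Notation C := (R[i] : numFieldType).

Lemma cvg_complex (u v : nat -> R) (a b : R) :
  u @ \oo --> a -> v @ \oo --> b ->
  (fun k => (u k +i* v k)%C : C) @ \oo --> ((a +i* b)%C : C).
Proof.
move=> ua vb; apply/(@cvgrPdist_lt C C^o) => e e0.
have [r r0 ->] : exists2 r : R, 0 < r & e = r%:C%C.
  by case: e e0 => r s; rewrite ltcE /= => /andP[/eqP -> r0]; exists r.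
have r2 : 0 < r / 2 by rewrite divr_gt0.
have /cvgrPdist_lt/(_ _ r2) := ua; have /cvgrPdist_lt/(_ _ r2) := vb.
apply: filterS2 => k vk uk.
have -> : ((a +i* b) - (u k +i* v k) = (a - u k)%:C + 'i * (b - v k)%:C)%C.
  by apply/eqP; rewrite eq_complex /=; apply/andP; split; apply/eqP; ring.
apply: le_lt_trans (ler_normD _ _) _.
rewrite normrM !normc_def /= !expr0n /= !addr0 add0r expr1n !sqrtr_sqr.
by rewrite sqrtr1 mul1r -rmorphD ltcR /=; lra.
Qed.

Lemma cvg_series_cis (t : R) :
  series (fun k : nat => (k`!)%:R^-1 * (0 +i* t)%C ^+ k : C) @ \oo --> (cis t : C).
Proof.
have termE k : (k`!)%:R^-1 * (0 +i* t)%C ^+ k =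
    (cos_coeff t k +i* sin_coeff t k)%C :> R[i].
  have itE : (0 +i* t)%C = 'i%C * t%:C%C.
    by apply/eqP; rewrite eq_complex /=; apply/andP; split; apply/eqP; ring.
  (* At [k = 0] the predecessor is truncated, but the factor [(odd k)%:R] is 0 there. *)
  have ik : 'i%C ^+ k =
      (((~~ odd k)%:R * (-1) ^+ k./2) +i*
       ((odd k)%:R * (-1) ^+ k.-1./2))%C :> R[i].
    rewrite -{1}[k]odd_double_half; case: odd (odd_double_half k) => /= kE.
      rewrite exprS -mul2n exprM sqr_i mul0r mul1r -kE /= uphalf_double ?doubleK.
      by apply/eqP; rewrite -(rmorphN1 (real_complex R)) -rmorphXn eq_complex /=;
        apply/andP; split; apply/eqP; ring.
    rewrite add0n -mul2n exprM sqr_i mul0r mul1r.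
    by rewrite -(rmorphN1 (real_complex R)) -rmorphXn.
  have signE n : (-1 : R) ^ Posz n = (-1) ^+ n by [].
  rewrite itE exprMn ik -rmorphXn /= -(rmorph_nat (real_complex R)) -fmorphV /=.
  by apply/eqP; rewrite eq_complex /=; apply/andP; split; apply/eqP;
    rewrite /cos_coeff /sin_coeff /= ?signE; move: (_^-1) => c; ring.
rewrite (_ : series _ = fun N : nat =>
  (series (cos_coeff t) N +i* series (sin_coeff t) N)%C); last first.
  apply/funext => N; rewrite /series /=; elim: N => [|N IHN].
    by rewrite !big_geq.
  by rewrite !big_nat_recr //= IHN termE.
apply: cvg_complex; rewrite unlock; [exact: is_cvg_series_cos_coeff|].
exact: is_cvg_series_sin_coeff.
Qed.

End CisSeries.

(** * Cayley graphs and perfect state transfer *)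

Section CharTable.
Variables (K : numClosedFieldType) (G : finZmodType).

(** The orthogonality relation computes the trace of [translation_mx g] in two ways: as the sum of
    its eigenvalues and as the number of fixed points of the translation. *)
Lemma char_table :
  exists2 Q : 'M[K]_#|G|, Q \in unitmx &
    exists X : 'I_#|G| -> G -> K,
      [/\ forall i, additive_char (X i),
          forall g, \sum_i X i g = (#|G| * (g == 0))%:R &
          forall g, translation_mx K g = invmx Q *m diag_mx (\row_i X i g) *m Q].
Proof.
have [Q Qu [X XP QX]] := translation_codiagonalizable K G.
exists Q => //; exists X; split=> // g.
rewrite -mxtrace_translation QX mxtrace_mulC mulmxA mulmxV // mul1mx.
by rewrite mxtrace_diag; apply: eq_bigr => i _; rewrite mxE.
Qed.

(** The eigenvalue of the Cayley graph attached to [chi]. *)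
Definition char_sum (C : {set G}) (chi : G -> K) : K := \sum_(g in C) chi g.

Lemma sum_translation_conj (Q : 'M[K]_#|G|) (X : 'I_#|G| -> G -> K) (f : G -> K) :
  (forall g, translation_mx K g = invmx Q *m diag_mx (\row_i X i g) *m Q) ->
  \sum_g f g *: translation_mx K g =
  invmx Q *m diag_mx (\row_i \sum_g f g * X i g) *m Q.
Proof.
move=> QX; transitivity (invmx Q *m (\sum_g f g *: diag_mx (\row_i X i g)) *m Q).
  rewrite mulmx_sumr mulmx_suml; apply: eq_bigr => g _.
  by rewrite QX -scalemxAr -scalemxAl.
congr (_ *m _ *m _); apply/matrixP => i j; rewrite summxE !mxE.
by rewrite -sumrMnl; apply: eq_bigr => g _; rewrite !mxE mulrnAr.
Qed.

Lemma adjmx_cayley (C : {set G}) :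
  adjmx K (cayley C) = \sum_g (g \in C)%:R *: translation_mx K g.
Proof.
apply/matrixP => i j; rewrite summxE !mxE /=.
rewrite (bigD1 (enum_val j - enum_val i)) //= big1 ?addr0 => [|g gij].
  by rewrite !mxE [enum_val i + _]addrC subrK eqxx mulr1.
rewrite !mxE; case: eqP => [E|_]; last by rewrite mulr0.
by rewrite E [enum_val i + _]addrC addrK eqxx in gij.
Qed.

Lemma adjmx_cayley_conj (C : {set G}) Q (X : 'I_#|G| -> G -> K) :
  (forall g, translation_mx K g = invmx Q *m diag_mx (\row_i X i g) *m Q) ->
  adjmx K (cayley C) = invmx Q *m diag_mx (\row_i char_sum C (X i)) *m Q.
Proof.
move=> QX; rewrite adjmx_cayley (sum_translation_conj _ QX).
congr (_ *m diag_mx _ *m _); apply/rowP => i; rewrite !mxE.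
rewrite /char_sum [RHS]big_mkcond; apply: eq_bigr => g _.
by case: (g \in C); rewrite ?mul1r ?mul0r.
Qed.

Lemma mul_conj_diagC n (Q : 'M[K]_n) (d e : 'rV[K]_n) : Q \in unitmx ->
  (invmx Q *m diag_mx d *m Q) *m (invmx Q *m diag_mx e *m Q) =
  (invmx Q *m diag_mx e *m Q) *m (invmx Q *m diag_mx d *m Q).
Proof.
move=> Qu; rewrite !mulmxA !(mulmxK Qu); congr (_ *m _).
by rewrite -[LHS]mulmxA -[RHS]mulmxA diag_mxC.
Qed.

(** Compare the entries [(0, y)] of the two products with the translation by [x]. *)
Lemma circulantE (M : 'M[K]_#|G|) :
  (forall g, translation_mx K g *m M = M *m translation_mx K g) ->
  forall x y, M (enum_rank x) (enum_rank y) =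
              M (enum_rank 0) (enum_rank (y - x)).
Proof.
move=> cM x y.
have := congr1 (fun N => fun_of_matrix N (enum_rank 0) (enum_rank y)) (cM x).
rewrite mul_translation_mx enum_rankK add0r => ->.
rewrite mxE (bigD1 (enum_rank (y - x))) //= big1 ?addr0 => [|k kyx].
  by rewrite !mxE !enum_rankK subrK eqxx mulr1.
rewrite !mxE enum_rankK; case: eqP => [E|_]; last by rewrite mulr0.
by rewrite E addrK enum_valK eqxx in kyx.
Qed.

Lemma circulant_sum (M : 'M[K]_#|G|) :
  (forall g, translation_mx K g *m M = M *m translation_mx K g) ->
  M = \sum_g M (enum_rank 0) (enum_rank g) *: translation_mx K g.
Proof.
move=> cM; apply/matrixP => i j.
rewrite -(enum_valK i) -(enum_valK j) circulantE // summxE.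
rewrite (bigD1 (enum_val j - enum_val i)) //= big1 ?addr0 => [|g gij].
  by rewrite !mxE ?enum_rankK [enum_val i + _]addrC subrK eqxx mulr1.
rewrite !mxE !enum_rankK; case: eqP => [E|_]; last by rewrite mulr0.
by rewrite E [enum_val i + _]addrC addrK eqxx in gij.
Qed.

(** [U] commutes with the translations, so it is their combination with coefficients from its row at
    0; undoing the conjugation and reading the diagonal gives the eigenvalues as the transform of
    that row. *)
Lemma conj_diag_circulant (Q : 'M[K]_#|G|) (X : 'I_#|G| -> G -> K)
    (e : 'rV[K]_#|G|) (U : 'M[K]_#|G|) :
  Q \in unitmx ->
  (forall g, translation_mx K g = invmx Q *m diag_mx (\row_i X i g) *m Q) ->
  U = invmx Q *m diag_mx e *m Q ->
  (forall x y, U (enum_rank x) (enum_rank y) =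
               U (enum_rank 0) (enum_rank (y - x))) /\
  (forall i, e 0 i = \sum_g U (enum_rank 0) (enum_rank g) * X i g).
Proof.
move=> Qu QX UE.
have U_comm g : translation_mx K g *m U = U *m translation_mx K g.
  by rewrite UE QX mul_conj_diagC.
split=> [|i]; first exact: circulantE.
have := circulant_sum U_comm; rewrite (sum_translation_conj _ QX) {1}UE.
move/(congr1 (fun M => Q *m M *m invmx Q)).
rewrite !mulmxA !mulmxV // !mul1mx !mulmxK //.
by move/matrixP/(_ i i); rewrite !mxE eqxx !mulr1n.
Qed.

(** At such a [g] every term of the orthogonality sum is 1, so the sum is not 0. *)
Lemma char_faithful (g : G) :
  (forall chi : G -> K, additive_char chi -> chi g = 1) -> g = 0.
Proof.
move=> g1; have [Q _ [X [XP X_orth _]]] := char_table.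
apply/eqP; have := X_orth g; under eq_bigr do rewrite (g1 _ (XP _)).
rewrite sumr_const card_ord; case: eqP => // _; rewrite muln0 => /eqP.
by rewrite (negPf (card_zmod_neq0 K G)).
Qed.

End CharTable.

(** * From perfect state transfer to an identity between characters and eigenvalues *)

Section Transfer.
Variables (R : realType) (G : finZmodType) (C : {set G}).
Hypothesis C_inv : forall x, x \in C -> - x \in C.
Local Notation lam := (char_sum (K := R[i]) C).

Lemma additive_charN (K : numClosedFieldType) (chi : G -> K) :
  additive_char chi -> additive_char (fun g => chi (- g)).
Proof.
move=> chiP; split=> [|g h]; first by rewrite oppr0 chiP.1.
by rewrite opprD chiP.2.
Qed.

Lemma char_sumN chi : lam (fun g => chi (- g)) = lam chi.
Proof.
rewrite /char_sum (reindex_inj oppr_inj); apply: eq_big => g; last by rewrite opprK.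
by apply/idP/idP => /C_inv; rewrite ?opprK.
Qed.

(** Conjugation replaces [chi g] by [chi (- g)], which only permutes the sum over the inverse-closed
    [C]. *)
Lemma char_sum_real chi : additive_char chi ->
  lam chi = (complex.Re (lam chi))%:C%C.
Proof.
move=> chiP; rewrite RRe_real // CrealE rmorph_sum /=.
apply/eqP; rewrite -[RHS]char_sumN.
by apply: eq_bigr => g _; rewrite conj_char.
Qed.

Lemma transition_cayley_conj (t : R) (Q : 'M[R[i]]_#|G|) (X : 'I_#|G| -> G -> R[i]) :
  Q \in unitmx -> (forall i, additive_char (X i)) ->
  (forall g, translation_mx R[i] g = invmx Q *m diag_mx (\row_i X i g) *m Q) ->
  transition_matrix (cayley C) t =
  invmx Q *m diag_mx (\row_i cis (t * complex.Re (lam (X i)))) *m Q.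
Proof.
move=> Qu XP QX; rewrite /transition_matrix (adjmx_cayley_conj C QX).
rewrite scalemxAl scalemxAr.
rewrite (_ : _ *: diag_mx _ =
  diag_mx (\row_i (0 +i* (t * complex.Re (lam (X i))))%C)); last first.
  apply/matrixP => i j; rewrite !mxE mulrnAr; congr (_ *+ _).
  rewrite [in LHS]char_sum_real //.
  by apply/eqP; rewrite eq_complex /=; apply/andP; split; apply/eqP; ring.
apply: expmx_conj => // i; rewrite !mxE; exact: cvg_series_cis.
Qed.

Lemma perfect_state_transfer_char : perfect_state_transfer R (cayley C) ->
  exists (t : R) (d : G) (gamma : R[i]),
    [/\ d != 0, d *+ 2 = 0 &
        forall chi : G -> R[i], additive_char chi ->
          cis (t * complex.Re (lam chi)) = gamma * chi d].
Proof.
case=> t [x [y [xy Uxy]]].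
have [Q Qu [X [XP X_orth QX]]] := char_table R[i] G.
have U_conj := transition_cayley_conj t Qu XP QX.
move: (transition_matrix _ _) Uxy U_conj => U Uxy U_conj.
pose u g := U (enum_rank 0) (enum_rank g).
have [U_circ u_hat] := conj_diag_circulant Qu QX U_conj.
have cisE i : cis (t * complex.Re (lam (X i))) = \sum_g u g * X i g.
  by rewrite -u_hat mxE.
(* By Parseval, eigenvalues of modulus 1 make the row at 0 a unit vector; its entry of modulus 1 at
   [d] then leaves nothing for the others. *)
have u_sum1 : \sum_g `|u g| ^+ 2 = 1.
  apply: (mulfI (card_zmod_neq0 R[i] G)).
  rewrite -(char_parseval XP X_orth) mulr1.
  under eq_bigr do rewrite -cisE norm_cis expr1n.
  by rewrite sumr_const card_ord.
pose d := y - x.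
have ud1 : `|u d| = 1 by rewrite -Uxy U_circ.
have u0 g : g != d -> u g = 0.
  move=> gd; move/eqP: u_sum1; rewrite (bigD1 d) //= ud1 expr1n.
  rewrite -subr_eq0 addrAC subrr add0r psumr_eq0 => [|h _];
    last by rewrite exprn_ge0 ?normr_ge0.
  move=> /allP/(_ g (mem_index_enum _)); rewrite gd /= expf_eq0 /= normr_eq0.
  by move/eqP.
have key chi : additive_char chi -> cis (t * complex.Re (lam chi)) = u d * chi d.
  move=> chiP; have [i <-] := char_complete XP X_orth chiP.
  by rewrite cisE (bigD1 d) //= big1 ?addr0 // => g /u0 ->; rewrite mul0r.
exists t, d, (u d); split=> //; first by rewrite subr_eq0 eq_sym.
apply: char_faithful => chi chiP.
have ud0 : u d != 0 by rewrite -normr_eq0 ud1 oner_eq0.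
(* [chi] and its inverse have the same eigenvalue, so [chi d = chi (- d)], which makes
   [chi (d *+ 2)] equal to 1. *)
have := key _ chiP; rewrite -char_sumN (key _ (additive_charN chiP)).
move/(mulfI ud0) => chi_d; rewrite mulr2n chiP.2 -{1}chi_d.
exact: charN_mul.
Qed.

End Transfer.

(** * Integrality and parity of the eigenvalues *)

Section IntegralSpectrum.
Variables (R : realType) (G : finZmodType) (C : {set G}).
Hypotheses (C_inv : forall x, x \in C -> - x \in C) (C_0 : 0 \notin C).
Local Notation lam := (char_sum (K := R[i]) C).

Lemma char_sum_alg_int chi : additive_char chi -> alg_int (lam chi).
Proof. by move=> chiP; apply: alg_int_sum => g _; apply: alg_int_char. Qed.

Variables (t : R) (d : G) (gamma : R[i]).
Hypotheses (d_neq0 : d != 0) (d2 : d *+ 2 = 0).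
Hypothesis transfer : forall chi : G -> R[i], additive_char chi ->
  cis (t * complex.Re (lam chi)) = gamma * chi d.

Let gamma_neq0 : gamma != 0.
Proof.
have := transfer (additive_char1 _ _); rewrite mulr1 => <-; exact: cis_neq0.
Qed.

Lemma char_involution chi : additive_char (K := R[i]) chi ->
  exists b : bool, chi d = (-1) ^+ b.
Proof.
move=> chiP; have : chi d ^+ 2 == 1 by rewrite -char_mulrn // d2 chiP.1.
by rewrite sqrf_eq1 => /orP[]/eqP->; [exists false|exists true].
Qed.

Lemma exists_odd_char : exists2 chi : G -> R[i], additive_char chi & chi d = -1.
Proof.
apply: contrapT => no; move/eqP: d_neq0; apply.
apply: (@char_faithful R[i]) => chi chiP.
by have [[] // chi_d] := char_involution chiP; case: no; exists chi.
Qed.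

(** Dividing the two transfer relations cancels [gamma] and leaves [cis] of the difference equal to
    a sign. *)
Lemma transfer_diff chi chi' (b : bool) :
  additive_char chi -> additive_char chi' -> chi d = (-1) ^+ b * chi' d ->
  exists N : int,
    t * (complex.Re (lam chi) - complex.Re (lam chi')) = pi *~ N /\ odd `|N|%N = b.
Proof.
move=> chiP chi'P chi_d; apply: cis_sign_eq.
rewrite mulrBr; set x := t * _; set y := t * _.
apply: (mulIf (cis_neq0 y)); rewrite -cisD subrK /x /y !transfer // chi_d.
by rewrite mulrCA.
Qed.

(** Serves the exact multiplicity: an eigenvalue of a character with [chi d = -1] belongs only to
    such characters. *)
Lemma char_sum_eq chi chi' : additive_char chi -> additive_char chi' ->
  lam chi = lam chi' -> chi d = chi' d.
Proof.
move=> chiP chi'P ll; apply: (mulfI gamma_neq0).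
by rewrite -!transfer // ll.
Qed.

(** Every eigenvalue differs from [k = #|C|] by an integer multiple of [pi / t]. Summing over the
    spectrum, whose total is 0, shows that [pi / t] is rational; a rational eigenvalue is an
    integer, being an algebraic integer. *)
Lemma char_sum_int chi : additive_char chi -> exists m : int, lam chi = m%:~R.
Proof.
move=> chiP; have [Q _ [X [XP X_orth _]]] := char_table R[i] G.
have one := additive_char1 R[i] G.
pose k := complex.Re (lam (fun=> 1)).
have lam1 : lam (fun=> 1) = #|C|%:R by rewrite /char_sum sumr_const.
have kE : k = #|C|%:R by rewrite /k lam1 -(rmorph_nat (real_complex R)).
have diff psi (psiP : additive_char psi) : exists N : int,
    t * (complex.Re (lam psi) - k) = pi *~ N.
  have [b psi_d] := char_involution psiP.
  have [|N [NE _]] := transfer_diff (b := b) psiP one; last by exists N.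
  by rewrite mulr1.
have /boolp.choice[N NE] (i : 'I_#|G|) := diff _ (XP i).
(* This is the trace of the adjacency matrix, which vanishes because [0 \notin C]. *)
have sum_lam : \sum_i complex.Re (lam (X i)) = 0.
  apply: (fmorph_inj (real_complex R)); rewrite rmorph_sum rmorph0 /=.
  under eq_bigr do rewrite -char_sum_real //.
  rewrite exchange_big big1 //= => g gC; rewrite X_orth.
  by case: eqP gC => [->|_]; rewrite ?(negPf C_0) ?muln0.
pose M := \sum_i N i.
have tM : t * (#|G|%:R * k) = - (pi * M%:~R).
  rewrite mulrzr mulrz_sumr; under eq_bigr do rewrite -NE.
  rewrite -mulr_sumr sumrB sum_lam sumr_const card_ord; ring.
have pi_neq0 : pi != 0 :> R by rewrite gt_eqF ?pi_gt0.
(* An odd [N1] is nonzero, which rules out [t = 0], and also [k = 0], since all eigenvalues vanish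
   for empty [C]. *)
have [chi1 chi1P chi1_d] := exists_odd_char.
have [|N1 [N1E N1_odd]] := transfer_diff (b := true) chi1P one.
  by rewrite chi1_d mulr1.
have tk_neq0 : t * (complex.Re (lam chi1) - k) != 0.
  rewrite N1E -mulrzr mulf_neq0 // intr_eq0.
  by apply/eqP => N10; rewrite N10 in N1_odd.
have t_neq0 : t != 0 by apply: contraNneq tk_neq0 => ->; rewrite mul0r.
have k_neq0 : k != 0.
  apply: contraNneq tk_neq0 => k0; rewrite k0 subr0.
  move/eqP: k0; rewrite kE pnatr_eq0 cards_eq0 => /eqP ->.
  by rewrite /char_sum big_set0 mulr0.
have n_neq0 : #|G|%:R != 0 :> R by rewrite pnatr_eq0 -lt0n; apply/card_gt0P; exists 0.
have M_neq0 : M%:~R != 0 :> R.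
  apply/eqP => M0; have /eqP := tM.
  by rewrite M0 mulr0 oppr0 !mulf_eq0 (negPf t_neq0) (negPf n_neq0) (negPf k_neq0).
have [N0 N0E] := diff _ chiP.
(* By [tM], [pi / t = - #|G| * k / M], and by [N0E] the eigenvalue is [k + N0 * pi / t]. *)
pose q : rat := #|C|%:R - N0%:~R * #|G|%:R * #|C|%:R / M%:~R.
have LE : complex.Re (lam chi) = ratr q.
  rewrite rmorphB /= !fmorph_div /= !rmorphM /= !ratr_int !ratr_nat -kE.
  apply: (mulIf M_neq0); apply: (mulfI t_neq0); apply: (mulfI pi_neq0).
  move: N0E; rewrite -mulrzr => N0E.
  rewrite mulrBl divfK //.
  have -> : pi * (t * (complex.Re (lam chi) * M%:~R)) =
    pi * M%:~R * (t * (complex.Re (lam chi) - k)) + pi * M%:~R * (t * k) by ring.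
  rewrite N0E; have -> : pi * M%:~R = - (t * (#|G|%:R * k)) by rewrite tM opprK.
  by ring: tM.
have lamE : lam chi = ratr q.
  by rewrite char_sum_real // LE fmorph_rat.
have [m qm] : exists m : int, q = m%:~R.
  by apply: (@rat_alg_int R[i]); rewrite -lamE; exact: char_sum_alg_int.
by exists m; rewrite lamE qm ratr_int.
Qed.

(** Comparing this difference with that of an odd and the trivial character eliminates [t]:
    [(m - m') * N1 = N2 * (m1 - k)] with [N1] odd and [N2] even. *)
Lemma char_sum_parity chi chi' (m m' : int) :
  additive_char chi -> additive_char chi' -> chi d = chi' d ->
  lam chi = m%:~R -> lam chi' = m'%:~R -> (2 %| m - m')%Z.
Proof.
move=> chiP chi'P chi_d lm lm'.
have Re_int (x : int) : complex.Re (x%:~R : R[i]) = x%:~R.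
  by rewrite -(rmorph_int (real_complex R)).
have one := additive_char1 R[i] G.
have [chi1 chi1P chi1_d] := exists_odd_char.
have [m1 lm1] := char_sum_int chi1P.
have [k lk] := char_sum_int one.
have [|N1 [N1E N1_odd]] := transfer_diff (b := true) chi1P one.
  by rewrite chi1_d mulr1.
have [|N2 [N2E N2_even]] := transfer_diff (b := false) chiP chi'P.
  by rewrite chi_d mul1r.
rewrite lm1 lk !Re_int -[pi *~ _]mulrzr -intrB in N1E.
rewrite lm lm' !Re_int -[pi *~ _]mulrzr -intrB in N2E.
have pi_neq0 : pi != 0 :> R by rewrite gt_eqF ?pi_gt0.
have : (m - m') * N1 = N2 * (m1 - k).
  apply: (@intr_inj R); apply: (mulfI pi_neq0); rewrite !intrM.
  by rewrite mulrCA -N1E [RHS]mulrA -N2E; ring.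
have : (2 %| N2)%Z by rewrite dvdzE dvdn2 N2_even.
move=> /(dvdz_mulr (m1 - k)) + E; rewrite -E Gauss_dvdzl //.
by rewrite coprimezE coprime2n.
Qed.

End IntegralSpectrum.

(** * Reduction modulo 2 *)

Section OddGroup.
Variables (K : numClosedFieldType) (H : finZmodType).
Hypothesis oddH : odd #|H|.

(** In the square, every cross term occurs twice. *)
Lemma alg_int_sqr_sum (I : Type) (r : seq I) (F : I -> K) :
  (forall i, alg_int (F i)) ->
  exists2 z, alg_int z &
    (\sum_(i <- r) F i) ^+ 2 = \sum_(i <- r) F i ^+ 2 + 2%:R * z.
Proof.
move=> Fi; elim: r => [|i r [z zi IHr]].
  by exists 0; [exact: (alg_int_intr K 0)|rewrite !big_nil; ring].
exists (z + F i * \sum_(j <- r) F j); last first.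
  by rewrite !big_cons sqrrD IHr; ring.
by apply: alg_intD => //; apply: alg_intM => //; apply: alg_int_sum.
Qed.

(* With 2 ^ k = 1 modulo #|H|, the right-hand sum is the transform of b itself. *)
Lemma frobenius_transform (b : H -> int) (phi : H -> K) k : additive_char phi ->
  exists2 z, alg_int z &
    (\sum_h (b h)%:~R * phi h) ^+ (2 ^ k) =
    \sum_h (b h)%:~R * phi h ^+ (2 ^ k) + 2%:R * z.
Proof.
move=> phiP; elim: k => [|k [z zi IHk]].
  exists 0; first exact: (alg_int_intr K 0).
  by rewrite expr1 mulr0 addr0; apply: eq_bigr => h _; rewrite expr1.
have Fi h : alg_int ((b h)%:~R * phi h ^+ (2 ^ k)).
  by apply: alg_intM; [exact: alg_int_intr|apply/alg_intX/alg_int_char].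
have [w wi wE] := alg_int_sqr_sum (index_enum H) Fi.
have /boolp.choice[c cE] (h : H) : exists c : int, b h ^+ 2 = b h + 2 * c.
  have /dvdzP[c cE] : (2 %| b h ^+ 2 - b h)%Z.
    have -> : b h ^+ 2 - b h = b h * (b h - 1) by ring.
    by rewrite dvdzE dvdn2 abszM oddM; lia.
  by exists c; lia.
(* The halved error terms of the squaring: [w] from the cross terms, [c] from replacing [b h ^+ 2]
   by [b h], and the terms in [z] inherited from level [k]. *)
exists (w + \sum_h (c h)%:~R * phi h ^+ (2 ^ k.+1) +
        2%:R * z * (\sum_h (b h)%:~R * phi h ^+ (2 ^ k)) + 2%:R * z ^+ 2).
  have two : alg_int (2%:R : K) := alg_int_intr K 2.
  have sum_int (f : H -> int) l : alg_int (\sum_h (f h)%:~R * phi h ^+ l).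
    apply: alg_int_sum => h _; apply: alg_intM; first exact: alg_int_intr.
    by apply/alg_intX/alg_int_char.
  apply: alg_intD; last by apply: alg_intM => //; apply: alg_intX.
  apply: alg_intD; first by apply: alg_intD.
  by apply: alg_intM => //; apply: alg_intM.
rewrite expnSr exprM IHk sqrrD wE.
have -> : \sum_h ((b h)%:~R * phi h ^+ (2 ^ k)) ^+ 2 =
    \sum_h (b h)%:~R * phi h ^+ (2 ^ k.+1) +
    2%:R * \sum_h (c h)%:~R * phi h ^+ (2 ^ k.+1).
  rewrite mulr_sumr -big_split; apply: eq_bigr => h _ /=.
  by rewrite exprMn -exprM -expnSr -rmorphXn /= cE intrD intrM; ring.
by rewrite -expnSr; ring.
Qed.

(* The transform B of b equals - 'i * m, so B ^+ (2 ^ k) = m ^+ (2 ^ k), which is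
   m modulo 2, and it is also B modulo 2 by Frobenius: 2 divides m * (1 + 'i), so
   m is even. *)
Lemma even_of_imaginary_transform (b : H -> int) :
  (forall phi : H -> K, additive_char phi ->
     exists m : int, 'i * (\sum_h (b h)%:~R * phi h) = m%:~R) ->
  forall h, (2 %| b h)%Z.
Proof.
move=> bi; have [Q _ [X [XP X_orth _]]] := char_table K H.
apply: (coef_dvdz_of_transform XP X_orth).
  by rewrite coprimezE coprime2n.
move=> phi phiP; have [m mE] := bi _ phiP.
set B := \sum_h _ in mE *.
have BE : B = - ('i * m%:~R) by rewrite -mE mulrA -expr2 sqrCi; ring.
(* By Euler, [2 ^ k] is 1 modulo the odd number [#|H|]; the factor 2 ensures [k >= 2], so that
   [(- 'i) ^+ (2 ^ k) = 1]. *)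
pose k := (2 * totient #|H|)%N.
have [z zi zE] := frobenius_transform b k phiP.
have phi_k h : phi h ^+ (2 ^ k) = phi h.
  rewrite -(expr_mod _ (char_unity_root phiP h)).
  have -> : 2 ^ k = 1 %[mod #|H|].
    by rewrite /k mulnC expnM -modnXm Euler_exp_totient ?coprime2n // modnXm exp1n.
  by rewrite expr_mod ?expr1 // char_unity_root.
have B_k : B ^+ (2 ^ k) = (m ^+ (2 ^ k))%:~R.
  have k2 : (2 ^ k = 4 * 2 ^ (k - 2))%N.
    rewrite -(expnD 2 2) subnKC // /k.
    have : (0 < totient #|H|)%N by rewrite totient_gt0 odd_gt0.
    lia.
  rewrite BE -mulNr exprMn k2 exprM.
  have -> : (- 'i) ^+ 4 = 1 :> K.
    by rewrite (exprM _ 2 2) sqrrN sqrCi -signr_odd.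
  by rewrite expr1n mul1r rmorphXn.
have [l lE] : exists l : int, m ^+ (2 ^ k) = m + 2 * l.
  have /dvdzP[l lE] : (2 %| m ^+ (2 ^ k) - m)%Z.
    rewrite dvdzE dvdn2; have : odd `|m ^+ (2 ^ k)|%N = odd `|m|%N.
      by rewrite abszX oddX; case: (2 ^ k)%N (expn_gt0 2 k).
    lia.
  by exists l; lia.
have m_even : (2 %| m)%Z.
  (* The two congruences combine to [(1 + 'i) * m = 2 * (z - l)]. Squaring and dividing by
     [(1 + 'i) ^+ 2 = 2 * 'i] gives the quotient of [m ^+ 2] by 2 supplied here. *)
  have : (2 %| m ^+ 2)%Z.
    apply: (@dvdz_alg_int K _ _ (- 'i * (z - l%:~R) ^+ 2)).
      apply: alg_intM; last by apply/alg_intX/alg_intB => //; apply: alg_int_intr.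
      apply: (@alg_int_unity_root _ _ 4) => //.
      by rewrite (exprM _ 2 2) sqrrN sqrCi -signr_odd.
    have zl : (1 + 'i) * m%:~R = 2%:R * (z - l%:~R) :> K.
      have : B ^+ (2 ^ k) = B + 2%:R * z.
        by rewrite zE; congr (_ + _); apply: eq_bigr => h _; rewrite phi_k.
      rewrite B_k lE intrD intrM BE => E.
      have -> : (1 + 'i) * m%:~R = 
        (m%:~R + 2%:R * l%:~R) + 'i * m%:~R - 2%:R * l%:~R :> K by ring.
      by rewrite E; ring.
    have i2 := sqrCi K.
    have i1 : (1 + 'i) ^+ 2 = 2%:R * 'i :> K by ring: i2.
    rewrite rmorphXn /=; apply: (@mulfI _ ((1 + 'i) ^+ 2)).
      by rewrite i1 mulf_neq0 ?neq0Ci ?pnatr_eq0.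
    by rewrite -exprMn zl i1; ring: i2.
  by rewrite !dvdzE !dvdn2 abszX oddX.
have /dvdzP[r rE] := m_even.
exists (- ('i * r%:~R)); last by rewrite BE rE intrM; ring.
rewrite -mulNr; apply: alg_intM; last exact: alg_int_intr.
apply: (@alg_int_unity_root _ _ 4) => //.
by rewrite (exprM _ 2 2) sqrrN sqrCi -signr_odd.
Qed.

End OddGroup.

(** * The four layers of the connection set *)

Section Z4Product.
Variables (K : numClosedFieldType) (H : finZmodType).
Hypothesis oddH : odd #|H|.
Variable C : {set 'Z_4 * H}.
Hypothesis C_0 : 0 \notin C.
Local Notation lam := (char_sum (K := K) C).

Definition indicator (j : 'Z_4) (h : H) : int := ((j, h) \in C)%:R.

Definition lift_char (s : K) (phi : H -> K) (g : 'Z_4 * H) : K :=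
  s ^+ g.1 * phi g.2.

Lemma lift_charP s phi : s ^+ 4 = 1 -> additive_char phi ->
  additive_char (lift_char s phi).
Proof.
move=> s4 phiP; split=> [|[j h] [j' h']]; rewrite /lift_char /=.
  by rewrite expr0 mul1r phiP.1.
have -> : s ^+ (j + j')%R = s ^+ j * s ^+ j'.
  by rewrite -exprD; exact: (expr_mod _ s4).
by rewrite phiP.2 mulrACA.
Qed.

(** Rests on [(j, h) = (1, 0) *+ j + (0, h)]. *)
Lemma char_of_lift (chi : 'Z_4 * H -> K) : additive_char chi ->
  additive_char (fun h => chi (0, h)) /\
  chi = lift_char (chi (1, 0)) (fun h => chi (0, h)).
Proof.
move=> chiP; split; first split=> [|h h']; first exact: chiP.1.
  by rewrite -chiP.2; rewrite -[(0, h) + _]/(0 + 0, h + h') addr0.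
apply/funext => -[j h]; rewrite /lift_char /= -char_mulrn // -chiP.2.
congr chi; rewrite pairMnE -[RHS]/(1 *+ j + 0, 0 *+ j + h).
by rewrite mul0rn add0r addr0 natr_Zp.
Qed.

(** The powers of [s] on the four layers are 1, [s], -1 and [- s], so layers 0 and 2 pair up, and so
    do 1 and 3. *)
Lemma char_sum_lift s phi : s ^+ 2 = -1 ->
  lam (lift_char s phi) =
    \sum_h (indicator 0 h - indicator 2%:R h)%:~R * phi h +
    s * \sum_h (indicator 1 h - indicator 3%:R h)%:~R * phi h.
Proof.
move=> s2; rewrite /char_sum big_mkcond /=.
transitivity (\sum_(j : 'Z_4) \sum_h (indicator j h)%:~R * (s ^+ j * phi h)).
  rewrite pair_bigA; apply: eq_bigr => -[j h] _; rewrite /indicator /lift_char /=.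
  by case: (_ \in C); rewrite ?mul1r ?mul0r.
rewrite 4!big_ord_recl big_ord0 addr0 mulr_sumr -!big_split /=.
apply: eq_bigr => h _; rewrite !intrB.
have e0 : ord0 = 0 :> 'Z_4 by exact/val_inj.
have e1 : lift ord0 ord0 = 1 :> 'Z_4 by exact/val_inj.
have e2 : lift ord0 (lift ord0 ord0) = 2%:R :> 'Z_4 by exact/val_inj.
have e3 : lift ord0 (lift ord0 (lift ord0 ord0)) = 3%:R :> 'Z_4 by exact/val_inj.
rewrite !(e0, e1, e2, e3) /=.
have -> : s ^+ 2%:R = -1 by [].
have -> : s ^+ 3%:R = - s by rewrite exprS s2 mulrN1.
by rewrite expr0 expr1; ring.
Qed.

Let a : 'Z_4 * H := (2%:R, 0).
Hypothesis lam_int : forall chi, additive_char chi -> exists m : int, lam chi = m%:~R.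
Hypothesis lam_parity : forall chi chi' (m m' : int),
  additive_char chi -> additive_char chi' -> chi a = chi' a ->
  lam chi = m%:~R -> lam chi' = m'%:~R -> (2 %| m - m')%Z.

Let i4 : 'i ^+ 4 = 1 :> K.
Proof. by rewrite (exprM _ 2 2) sqrCi -signr_odd. Qed.
Let Ni4 : (- 'i) ^+ 4 = 1 :> K.
Proof. by rewrite (exprM _ 2 2) sqrrN sqrCi -signr_odd. Qed.
Let Ni2 : (- 'i) ^+ 2 = -1 :> K.
Proof. by rewrite sqrrN sqrCi. Qed.
Let lift_a s phi : additive_char phi -> s ^+ 2 = -1 -> lift_char s phi a = -1.
Proof. by move=> phiP s2; rewrite /lift_char /= phiP.1 mulr1. Qed.

(** The lifts of [phi] by ['i] and [- 'i] take the same value at [a], so their integer eigenvalues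
    differ by an even number. Half of this difference is ['i] times the transform of the layer
    difference, which is therefore even at each [h]; its values are only -1, 0 and 1. *)
Lemma odd_layers_eq h : indicator 1 h = indicator 3%:R h.
Proof.
suff : (2 %| indicator 1%R h - indicator 3%:R h)%Z.
  by rewrite /indicator dvdzE; do 2!case: (_ \in C).
apply: (even_of_imaginary_transform (K := K) oddH
  (b := fun h => indicator 1 h - indicator 3%:R h)) => phi phiP.
have liP := lift_charP i4 phiP; have lNiP := lift_charP Ni4 phiP.
have [m mE] := lam_int liP; have [m' m'E] := lam_int lNiP.
have : (2 %| m - m')%Z.
  by apply: (lam_parity liP lNiP) => //; rewrite !lift_a // sqrCi.
case/dvdzP => l lE; exists l.
apply: (@mulfI _ 2%:R); first by rewrite pnatr_eq0.
transitivity ((m - m')%:~R : K); last by rewrite lE intrM mulrC.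
rewrite intrB -mE -m'E !char_sum_lift ?sqrCi //; ring.
Qed.

Lemma char_sum_lift_even s phi : s ^+ 2 = -1 ->
  lam (lift_char s phi) =
    \sum_h (indicator 0 h - indicator 2%:R h)%:~R * phi h.
Proof.
move=> s2; rewrite char_sum_lift // [X in s * X]big1 ?mulr0 ?addr0 // => h _.
by rewrite odd_layers_eq subrr mul0r.
Qed.

(** All lifts by ['i] have eigenvalues congruent modulo 2 to the one, [e], of the trivial [phi]. The
    constant [e] is the transform of [e] times the point mass at 0, so the layer difference is even
    away from 0, hence 0 there. *)
Lemma even_layers_eq h : h != 0 -> indicator 0 h = indicator 2%:R h.
Proof.
move=> h0; have one := additive_char1 K H.
have [e eE] := lam_int (lift_charP i4 one).
suff : (2 %| indicator 0%R h - indicator 2%:R h - e * (h == 0%R)%:R)%Z.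
  by rewrite (negPf h0) mulr0 subr0 /indicator dvdzE; do 2!case: (_ \in C).
have [Q _ [X [XP X_orth _]]] := char_table K H.
apply: (coef_dvdz_of_transform XP X_orth
  (f := fun h => indicator 0 h - indicator 2%:R h - e * (h == 0)%:R)).
  by rewrite coprimezE coprime2n.
move=> phi phiP; have liP := lift_charP i4 phiP.
have [m mE] := lam_int liP.
have : (2 %| m - e)%Z.
  apply: (lam_parity liP (lift_charP i4 one)) => //.
  by rewrite !lift_a // sqrCi.
case/dvdzP => l lE; exists l%:~R; first exact: alg_int_intr.
transitivity ((m - e)%:~R : K); last by rewrite lE intrM mulrC.
rewrite intrB -mE char_sum_lift_even ?sqrCi //.
have -> : e%:~R = \sum_h (e * (h == 0)%:R)%:~R * phi h.
  rewrite (bigD1 0) //= big1 ?addr0 => [|g g0].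
    by rewrite eqxx mulr1 phiP.1 mulr1.
  by rewrite (negPf g0) mulr0 mul0r.
rewrite -sumrB; apply: eq_bigr => g _; rewrite [in LHS]intrB; ring.
Qed.

(** Only the term [h = 0] survives, where layer 0 contributes nothing because [0 \notin C] and layer
    2 contributes [a]. *)
Lemma char_sum_odd chi : additive_char chi -> chi a = -1 ->
  lam chi = - (a \in C)%:R.
Proof.
move=> chiP chi_a; have [phiP chiE] := char_of_lift chiP.
have s2 : chi (1, 0) ^+ 2 = -1.
  rewrite -char_mulrn // -chi_a; congr chi.
  by rewrite pairMnE mul0rn.
rewrite chiE char_sum_lift_even // (bigD1 0) //= big1 ?addr0 => [|h h0].
  rewrite phiP.1 mulr1 /indicator (negPf C_0) sub0r -/a.
  by rewrite intrN; case: (a \in C).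
by rewrite even_layers_eq // subrr mul0r.
Qed.

(** Equal layers cancel modulo 2, leaving the points [(0, 0)] and [a]. *)
Lemma card_parity : odd #|C| = (a \in C).
Proof.
pose c (j : 'Z_4) (h : H) : nat := (j, h) \in C.
have cE j j' h : indicator j h = indicator j' h -> c j h = c j' h.
  by rewrite /indicator /c; do 2!case: (_ \in C).
have -> : #|C| = (\sum_(j : 'Z_4) \sum_h c j h)%N.
  rewrite pair_bigA -sum1_card big_mkcond; apply: eq_bigr => -[j h] _.
  by rewrite /c /=; case: (_ \in C).
rewrite 4!big_ord_recl big_ord0 addn0.
have e0 : ord0 = 0 :> 'Z_4 by exact/val_inj.
have e1 : lift ord0 ord0 = 1 :> 'Z_4 by exact/val_inj.
have e2 : lift ord0 (lift ord0 ord0) = 2%:R :> 'Z_4 by exact/val_inj.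
have e3 : lift ord0 (lift ord0 (lift ord0 ord0)) = 3%:R :> 'Z_4 by exact/val_inj.
rewrite !(e0, e1, e2, e3) [in X in odd X](bigD1 0) //=.
rewrite [X in odd (_ + (_ + (X + _)))](bigD1 0) //=.
rewrite (eq_bigr (c 2%:R)) => [|h h0]; last exact/cE/even_layers_eq.
rewrite [X in odd (_ + (X + _))](eq_bigr (c 3%:R)) => [|h _];
  last exact/cE/odd_layers_eq.
have -> : c 0 0 = 0%N by rewrite /c (negPf C_0).
have -> : c 2%:R 0 = (a \in C) by [].
rewrite add0n !oddD.
case: (odd (\sum_(i | _) _)); case: (odd (\sum_i c 3%:R i));
  by case: (a \in C).
Qed.
End Z4Product.

(** * Multiplicities and the final count *)

Lemma char_poly_conj (K : fieldType) n (Q : 'M[K]_n) (d : 'rV[K]_n) :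
  Q \in unitmx ->
  char_poly (invmx Q *m diag_mx d *m Q) = \prod_i ('X - (d 0 i)%:P).
Proof.
move=> Qu; transitivity (char_poly (diag_mx d)); last first.
  rewrite char_poly_trig ?diag_mx_is_trig //.
  by apply: eq_bigr => i _; rewrite mxE eqxx.
rewrite /char_poly /char_poly_mx !map_mxM /=.
have XE : 'X%:M = map_mx polyC (invmx Q) *m 'X%:M *m map_mx polyC Q.
  by rewrite scalar_mxC -mulmxA -map_mxM mulVmx // map_mx1 mulmx1.
rewrite [in LHS]XE -mulmxBl -mulmxBr !det_mulmx mulrAC -det_mulmx -map_mxM mulVmx //.
by rewrite map_mx1 det1 mul1r.
Qed.

Lemma mup_prod_XsubC (K : fieldType) (I : finType) (F : I -> K) (x : K) :
  mup x (\prod_i ('X - (F i)%:P)) = #|[pred i | F i == x]|.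
Proof.
rewrite -(big_map F predT (fun y => 'X - y%:P)) mu_prod_XsubC count_map.
by rewrite -sum1_count -sum1_card.
Qed.

(** As [F i = 1 - 2 * (F i == -1)], the sum equals [#|I| - 2 * m]. *)
Lemma sum_signs_eq0_card (K : numFieldType) (I : finType) (F : I -> K) :
  (forall i, F i = 1 \/ F i = -1) -> \sum_i F i = 0 ->
  #|[pred i | F i == -1]| = (#|I| %/ 2)%N.
Proof.
move=> F1 sumF; set m := #|_|.
have N1 : (1 == -1 :> K) = false.
  by apply/negbTE; rewrite -addr_eq0 -mulr2n pnatr_eq0.
suff -> : #|I| = (m * 2)%N by rewrite mulnK.
apply/eqP; rewrite -(eqr_nat K) -subr_eq0 -{}sumF.
have IE : #|I|%:R = \sum_(i : I) 1 :> K by rewrite sumr_const.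
have mE : m%:R = \sum_i (F i == -1)%:R :> K.
  rewrite /m -sum1_card natr_sum big_mkcond; apply: eq_bigr => i _.
  by rewrite inE; case: eqP.
rewrite natrM IE mE mulr_suml -sumrB; apply/eqP/eq_bigr => i _.
by case: (F1 i) => ->; rewrite ?eqxx ?N1 /= ?mulr0n ?mulr1n; ring.
Qed.

(** The component in [H] is killed by both 2 and the odd number [#|H|], hence is 0. *)
Lemma two_torsion_Z4 (H : finZmodType) (d : 'Z_4 * H) :
  odd #|H| -> d != 0 -> d *+ 2 = 0 -> d = (2%:R, 0).
Proof.
case: d => j h oddH d0 /eqP; rewrite pairMnE -pair_eqE /= => /andP[/eqP j2 /eqP h2].
have h0 : h = 0.
  have := mulrn_card h; rewrite -(odd_double_half #|H|) oddH mulrnDr -mul2n.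
  by rewrite mulrnA h2 mul0rn addr0.
have [j0|->] : j = 0 \/ j = 2%:R; last by rewrite h0.
  move: j2; case: j {d0} => -[|[|[|[|//]]]] i; try by move/(congr1 val).
    by left; apply/val_inj.
  by right; apply/val_inj.
by rewrite j0 h0 eqxx in d0.
Qed.

Theorem corollary8p4 (R : realType) (H : finZmodType) (oddH : odd #|H|)
    (C : {set 'Z_4 * H}) (C_inv : forall x, x \in C -> - x \in C)
    (C_0 : 0 \notin C)
    (pst : perfect_state_transfer R (cayley C)) :
  let a : 'Z_4 * H := (2%:R, 0) in
  let A : 'M[R[i]]_#|{: 'Z_4 * H}| := adjmx R[i] (cayley C) in
  (a \in C ->
     (forall z : R[i], eigenvalue A z ->
        exists m : int, odd `|m|%N /\ z = m%:~R) /\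
     eigenvalue_mult A (-1) (#|{: 'Z_4 * H}| %/ 2)) /\
  (a \notin C ->
     (forall z : R[i], eigenvalue A z ->
        exists m : int, ~~ odd `|m|%N /\ z = m%:~R) /\
     eigenvalue_mult A 0 (#|{: 'Z_4 * H}| %/ 2)).

Proof.
move=> a A.
have [t [d [gamma [d0 d2 transfer]]]] := perfect_state_transfer_char C_inv pst.
have da : d = a by exact: two_torsion_Z4.
rewrite {d}da in d0 d2 transfer.
have lam_int := char_sum_int C_inv C_0 d0 d2 transfer.
have lam_parity := char_sum_parity C_inv C_0 d0 d2 transfer.
have lam_odd := char_sum_odd oddH C_0 lam_int lam_parity.
have card_odd := card_parity oddH C_0 lam_int lam_parity.
have [Q Qu [X [XP X_orth QX]]] := char_table R[i] ('Z_4 * H)%type.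
have A_poly : char_poly A = \prod_i ('X - (char_sum C (X i))%:P).
  rewrite /A (adjmx_cayley_conj C QX) char_poly_conj //.
  by apply: eq_bigr => i _; rewrite mxE.
have X_a i : X i a = 1 \/ X i a = -1.
  by have [[] ->] := char_involution d2 (XP i); [right|left].
(* When [X i a = 1], compare with the trivial character, whose eigenvalue is [#|C|]; when
   [X i a = -1], the eigenvalue is known exactly. *)
have odd_lam i (m : int) : char_sum C (X i) = m%:~R -> odd `|m|%N = (a \in C).
  case: (X_a i) => Xia mE.
    have := lam_parity _ _ m #|C| (XP i) (additive_char1 _ _) Xia mE.
    rewrite /char_sum sumr_const => /(_ erefl).
    by rewrite -card_odd dvdzE dvdn2; lia.
  move: mE; rewrite lam_odd // => mE; have -> : m = - (a \in C)%:R.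
    by apply: (@intr_inj R[i]); rewrite -mE rmorphN /= rmorph_nat.
  by case: (a \in C).
have eigen z : eigenvalue A z -> exists i, z = char_sum C (X i).
  rewrite eigenvalue_root_char A_poly /root horner_prod prodf_seq_eq0.
  by case/hasP => i _; rewrite !hornerE subr_eq0 => /eqP ->; exists i.
have mult : eigenvalue_mult A (- (a \in C)%:R) (#|{: 'Z_4 * H}| %/ 2).
  have [chi chiP chi_a] := exists_odd_char R d0 d2.
  split.
    have [i iE] := char_complete XP X_orth chiP.
    rewrite eigenvalue_root_char A_poly /root horner_prod prodf_seq_eq0.
    apply/hasP; exists i; first exact: mem_index_enum.
    by rewrite iE lam_odd // !hornerE subrr.
  rewrite A_poly mup_prod_XsubC -[X in (X %/ 2)%N]card_ord.
  (* The signs [X i a] sum to 0 by orthogonality, as [a != 0], so half of them are -1. *)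
  rewrite -(sum_signs_eq0_card X_a); last by rewrite X_orth (negPf d0) muln0.
  (* An index with this eigenvalue shares it with [chi], hence has the same sign -1 at [a]. *)
  apply: eq_card => i; rewrite !inE; apply/eqP/eqP => [lam_i|]; last exact: lam_odd.
  by rewrite -chi_a; apply: (char_sum_eq transfer) => //; rewrite lam_i lam_odd.
split=> aC; (split; last by move: mult; rewrite ?aC ?(negPf aC) ?oppr0).
  by move=> z /eigen[i ->]; have [m mE] := lam_int _ (XP i); exists m;
    rewrite (odd_lam i).
by move=> z /eigen[i ->]; have [m mE] := lam_int _ (XP i); exists m;
  rewrite (odd_lam i).
Qed.
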